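(* Let $F$ be a field of finite (prime) characteristic $p$, let $A=(a_{ij})_{1\le i,j\le 3}$ be a $3\times3$ matrix over $F$ with $a_{12}a_{23}a_{31}\ne a_{13}a_{32}a_{21}$, and let $R$ be the $p\times p\times p$ block made of copies of $A$. Let $\mathsf r=(a_{ij}^p)_{1\le i,j\le 3}$ and let $\mathsf r^{\mathrm T}=(a_{ji}^p)_{1\le i,j\le 3}$ be its transpose. Then, choosing a proper basis in each of the three thick spaces $\mathbf V_1,\mathbf V_2,\mathbf V_3$, one can bring $R$ to the form of the direct sum of $\frac{p(p-1)}{2}$ matrices $\mathsf r^{\mathrm T}$ and $\frac{p(p+1)}{2}$ matrices $\mathsf r$.
   Context: Conventions: vectors are rows and operators/matrices act from the right, so in a product the leftmost factor is applied first. Block. Let $C=\{\mathbf x\in\mathbb Z^3: 0\le x_i\le p-1\}$. To every straight line that is parallel to the $i$-th coordinate axis and passes through points of $C$ attach a copy of the one-dimensional space $V_i=F$. To every $\mathbf x\in C$ attach a copy $A^{(\mathbf x)}$ of $A$ acting in the direct sum of the copies of $V_1,V_2,V_3$ attached to the three lines meeting at $\mathbf x$, extended by the identity to all the other copies. The $p\times p\times p$ block is $R=\prod_{\mathbf x\in C}A^{(\mathbf x)}$, taken in any order such that $A^{(\mathbf x)}$ stands to the left of $A^{(\mathbf y)}$ whenever $\mathbf x\ne\mathbf y$ and $x_i\le y_i$ for all $i$ (the result does not depend on the choice of such an order). Thick spaces. $\mathbf V_i$ is the direct sum of the $p^2$ copies of $V_i$ attached to the lines parallel to the $i$-th axis;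 $R$ acts in $\mathbf V_1\oplus\mathbf V_2\oplus\mathbf V_3$. Direct sum. ''Direct sum'' means that there are bases $\{v^{(i)}_1,\dots,v^{(i)}_{p^2}\}$ of $\mathbf V_i$ ($i=1,2,3$) such that, for each $k$, the span of $v^{(1)}_k,v^{(2)}_k,v^{(3)}_k$ is invariant under $R$ and $R$ acts there by the $k$-th matrix summand $M=(m_{ij})$: $v^{(i)}_kR=\sum_j m_{ij}v^{(j)}_k$. *)

(* Defs.v *)
From HB Require Import structures.
From mathcomp Require Import all_boot all_order all_algebra.

Set Implicit Arguments.
Unset Strict Implicit.
Unset Printing Implicit Defensive.

Import Order.TTheory GRing.Theory.
Local Open Scope ring_scope.

(* Coordinates 1, 2, 3 are indexed by 0, 1, 2 : 'I_3, and row vectors are     *)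
(* acted upon from the right, so that the leftmost factor acts first.         *)

Definition point (p : nat) := {ffun 'I_3 -> 'I_p}.

(* (i, u) is the line parallel to the i-th axis on which the two remaining    *)
(* coordinates, taken in increasing order of their index, are u 0 and u 1.    *)
Definition line (p : nat) := ('I_3 * {ffun 'I_2 -> 'I_p})%type.

Definition line_through p (x : point p) (i : 'I_3) : line p :=
  (i, [ffun j : 'I_2 => x (lift i j)]).

Definition on_line p (x : point p) (l : line p) : bool :=
  l == line_through x l.1.

(* The direct sum of the copies of F attached to all lines is                 *)
(* 'rV[F]_#|{: line p}|, with coordinates numbered by enum_rank / enum_val.   *)
Definition local_mx (F : fieldType) p (A : 'M[F]_3) (x : point p) :
    'M[F]_#|{: line p}| :=
  \matrix_(a, b)
    let l := enum_val a in let l' := enum_val b in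
    if on_line x l && on_line x l' then A l.1 l'.1 else (l == l')%:R.

Definition admissible_order p (s : seq (point p)) : Prop :=
  [/\ uniq s, forall x, x \in s
    & forall x y : point p, x != y -> (forall i, (x i <= y i)%N) ->
        (index x s < index y s)%N].

(* The block, with its factors taken in the order s. *)
Definition block (F : fieldType) p (A : 'M[F]_3) (s : seq (point p)) :
    'M[F]_#|{: line p}| :=
  \prod_(x <- s) local_mx A x.

Definition thick (F : fieldType) p (i : 'I_3) :
    {vspace 'rV[F]_#|{: line p}|} :=
  <<[seq delta_mx ord0 (enum_rank ((i, u) : line p))
      | u : {ffun 'I_2 -> 'I_p}]>>%VS.

(* The displayed equations entail the invariance under R of the span of       *)
(* the three k-th basis vectors.                                              *)
Definition is_direct_sum (F : fieldType) p (R : 'M[F]_#|{: line p}|)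
    (ms : seq 'M[F]_3) : Prop :=
  size ms = (p ^ 2)%N /\
  exists v : 'I_3 -> (p ^ 2).-tuple 'rV[F]_#|{: line p}|,
    (forall i, basis_of (thick F p i) (v i)) /\
    (forall (k : 'I_(p ^ 2)) (i : 'I_3),
       tnth (v i) k *m R = \sum_j (nth 0 ms k) i j *: tnth (v j) k).

(* Sorting by the sum of the coordinates gives an admissible order. *)
Lemma admissible_order_exists p : exists s, @admissible_order p s.
Proof.
pose f (x : point p) := (\sum_i x i)%N.
pose r (x y : point p) := (f x <= f y)%N.
have rtot : total r by move=> x y; apply: leq_total.
have rtr : transitive r by move=> y x z; apply: leq_trans.
exists (sort r (enum {: point p})); split.
- by rewrite sort_uniq enum_uniq.
- by move=> x; rewrite mem_sort mem_enum.
move=> x y neq_xy le_xy.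
have [i lt_i] : exists i, (x i < y i)%N.
  apply/existsP; apply: contraR neq_xy => /existsPn ge_xy.
  apply/eqP/ffunP => i; apply/val_inj/anti_leq.
  by rewrite le_xy leqNgt ge_xy.
have lt_f : (f x < f y)%N.
  rewrite /f (bigD1 i) //= [X in (_ < X)%N](bigD1 i) //= -addSn.
  by apply: leq_add => //; apply: leq_sum => j _.
rewrite ltnNge; apply/negP => le_idx.
have srt := sort_sorted rtot (enum {: point p}).
have rr : reflexive r by move=> z; apply: leqnn.
have in_s z : z \in sort r (enum {: point p}) by rewrite mem_sort mem_enum.
have := sorted_leq_index rtr rr srt y x (in_s y) (in_s x) le_idx.
by rewrite /r leqNgt lt_f.
Qed.

(* Main.v *)
Require Import Defs.
From HB Require Import structures.
From mathcomp Require Import all_boot all_order all_algebra.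
From mathcomp Require Import zify ring.
From mathcomp Require Import mpoly.

Set Implicit Arguments.
Unset Strict Implicit.
Unset Printing Implicit Defensive.

Import Order.TTheory GRing.Theory.
Local Open Scope ring_scope.

(** Call a field a family of scalars psi_i(x), one for each edge entering the
    lattice point x along the i-th axis, such that at every point
    psi_j(x + e_j) = \sum_i psi_i(x) a_ij.  The block R maps the values of a field
    on the entering faces of the cube to its values on the leaving faces
    ([block_transfer]), so it is enough to have enough explicit fields.

    Plane waves psi_i(x) = c_i z^x are fields when c A = c diag(z), hence when z
    lies on the cubic surface det(A - diag z) = 0.  Let u = a12 a23 a31 and
    v = a13 a32 a21.  Because u and v differ, each z_i is a fractional linear
    function z_i = Z_i / N_i of a coordinate (s_i : t_i) on the projective line,
    where Z_i and N_i are the linear forms in [chart_mx]; these can be chosen so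
    that, with c_i N_i in place of c_i, the equations of the wave become the
    binomial ones c_i t_i = c_{i+1} s_{i+1} ([edge_formP]).  The surface is therefore toric, and it is
    parametrized by monomials in three variables: s_i = X_i, t_i = X_{i+2},
    c_i = X_{i+1}, with indices modulo 3.  Clearing denominators, a plane wave is a
    field with values in polynomials in X_0, X_1, X_2, so each of its coefficients
    is a scalar field.

    On the i-th entering face the wave is c_i N_i^p times a form of degree p - 1 in
    each of the pairs (s_{i+1}, t_{i+1}) and (s_{i+2}, t_{i+2}); on the leaving face
    N_i^p becomes Z_i^p ([wave_face]).  Expanding these forms in monomials gives a
    basis of the i-th thick space ([face_basis]).  In characteristic p the powers
    N_i^p and Z_i^p are combinations of s_i^p and t_i^p alone, with the coefficients
    of the chart raised to the power p.  So R respects the grading of the monomials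
    by their exponents modulo p.  A monomial of the wave has degree 3p - 1, so its
    three residues add up to p - 1 or to 2p - 1, and every such triple of residues
    occurs for exactly one vector of each basis ([slot]).

    For one triple of residues the coefficients of the wave are three, each the sum
    of a term c_i s_i^p m and a term c_j t_j^p m', with m and m' monomials as above.
    For sum p - 1, j = i + 2, which is the same pattern of equations as
    the one satisfied by a single matrix with entries a_ij^p ([solve_chart]); for
    sum 2p - 1, j = i + 1, the pattern of its transpose ([solve_chart_tr]).
    There are p(p + 1)/2 and p(p - 1)/2 triples of the two kinds. *)

(** * Fields on the edges and the action of the block *)

Definition line_point p (l : line p) (n : nat) : {ffun 'I_3 -> nat} :=
  [ffun k => if unlift l.1 k is Some j then l.2 j : nat else n].

(** The position [n l] reached on a line may vary with the line: this describes
    the stage of the evolution where only some points of the cube have acted. *)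
Definition face_row (F : fieldType) p (psi : 'I_3 -> {ffun 'I_3 -> nat} -> F)
    (n : line p -> nat) : 'rV[F]_#|{: line p}| :=
  \row_a let l := enum_val a in psi l.1 (line_point l (n l)).

Lemma line_point_through p (x : point p) i n k :
  line_point (line_through x i) n k = if k == i then n else x k.
Proof.
rewrite ffunE /=; case: unliftP => [j ->|->]; last by rewrite eqxx.
by rewrite ffunE eq_sym (negPf (neq_lift _ _)).
Qed.

Lemma line_point_at p (x : point p) i :
  line_point (line_through x i) (x i) = [ffun k => x k : nat].
Proof. by apply/ffunP => k; rewrite line_point_through ffunE; case: eqP => // ->. Qed.

Lemma sum_on_line (V : zmodType) p (x : point p) (f : line p -> V) :
  \sum_(l | on_line x l) f l = \sum_i f (line_through x i).
Proof.
rewrite (reindex_onto (line_through x) (fun l : line p => l.1)); last by move=> l /eqP<-.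
by apply: eq_bigl => i /=; rewrite /on_line /= !eqxx.
Qed.

(** The point [x] advances its three lines by one step, by the equation of the
    field at [x], and leaves all the other lines alone. *)
Lemma face_row_local (F : fieldType) p (A : 'M[F]_3) (x : point p) psi
    (n n' : line p -> nat) :
  (forall j, psi j (line_point (line_through x j) (x j).+1)
     = \sum_i psi i [ffun k => x k : nat] * A i j) ->
  (forall i, n (line_through x i) = x i) ->
  (forall l, n' l = n l + on_line x l)%N ->
  face_row psi n *m local_mx A x = face_row psi n'.
Proof.
move=> psiP nx n'E; apply/rowP => b; rewrite !mxE /=.
rewrite (reindex (@enum_rank (line p))) /=; last exact/onW_bij/enum_rank_bij.
under eq_bigr do rewrite !mxE /= enum_rankK.
set l' := enum_val b; rewrite n'E; case: (boolP (on_line x l')) => [on_l'|_].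
  under eq_bigr do rewrite andbT.
  rewrite (bigID (on_line x)) /= [X in _ + X]big1 ?addr0 => [|l /negPf off_l].
    under eq_bigr => l on_l do rewrite on_l.
    have def_l' := eqP on_l'.
    have -> : n l' = x l'.1 by rewrite {1}def_l' nx.
    rewrite [in RHS]def_l' addn1 /= psiP sum_on_line.
    by apply: eq_bigr => i _; rewrite nx line_point_at.
  rewrite off_l; case: eqP => [ll'|_]; last by rewrite mulr0.
  by rewrite ll' on_l' in off_l.
under eq_bigr do rewrite andbF.
rewrite (bigD1 l') //= eqxx mulr1 addn0 big1 ?addr0 // => l /negPf->.
by rewrite mulr0.
Qed.

Definition cube_point p (l : line p) (m : 'I_p) : point p :=
  [ffun k => if unlift l.1 k is Some j then l.2 j else m].

Lemma cube_point_inj p (l : line p) : injective (cube_point l).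
Proof. by move=> m m' /ffunP/(_ l.1); rewrite !ffunE unlift_none. Qed.

Lemma on_lineE p (l : line p) z : on_line z l = (z == cube_point l (z l.1)).
Proof.
apply/eqP/eqP => [lz|->]; last first.
  rewrite /line_through [LHS]surjective_pairing; congr pair.
  by apply/ffunP=> j; rewrite !ffunE liftK.
apply/ffunP=> k; rewrite ffunE /=.
by case: unliftP => [j ->|-> //]; rewrite {2}lz ffunE.
Qed.

Lemma count_on_line p (l : line p) (s : seq (point p)) n :
  uniq s -> (n <= p)%N -> (forall m, (cube_point l m \in s) = (m < n)%N) ->
  count (fun y => on_line y l) s = n.
Proof.
move=> s_uniq le_np s_mem.
have -> : n = size [seq cube_point l m | m : 'I_p <- enum 'I_p & (m < n)%N].
  rewrite size_map size_filter -sum1_count big_enum_cond /=.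
  by rewrite -(big_ord_widen p (fun=> 1%N)) ?sum1_card ?card_ord.
rewrite -size_filter; apply/perm_size/uniq_perm.
- exact: filter_uniq.
- by rewrite (map_inj_uniq (@cube_point_inj p l)) // filter_uniq // enum_uniq.
move=> z; rewrite mem_filter on_lineE; apply/andP/mapP => [[/eqP-> zs]|[m]].
  by exists (z l.1); rewrite // mem_filter mem_enum -s_mem zs.
by rewrite mem_filter -s_mem => /andP[s_m _] ->; rewrite s_m ffunE unlift_none eqxx.
Qed.

(** An admissible order meets the points of a line in increasing order, so when
    it comes to [x] exactly the points below [x] on that line have acted. *)
Lemma count_below_line p (x : point p) i s1 s2 :
  admissible_order (s1 ++ x :: s2) ->
  count (fun y => on_line y (line_through x i)) s1 = x i.
Proof.
move=> [s_uniq s_all s_mono]; set l := line_through x i.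
have uniq1 : uniq s1 by move: s_uniq; rewrite cat_uniq => /and3P[].
have x_notin1 : x \notin s1.
  by move: s_uniq; rewrite cat_uniq /= negb_or => /and3P[_ /andP[]].
have idx_x : index x (s1 ++ x :: s2) = size s1.
  by rewrite index_cat (negPf x_notin1) /= eqxx addn0.
have in_s1 z : (z \in s1) = (index z (s1 ++ x :: s2) < size s1)%N.
  rewrite index_cat; case: ifP => [zs1|_]; first by rewrite index_mem.
  by rewrite ltnNge leq_addr.
have yE m k : cube_point l m k = if k == i then m else x k.
  rewrite ffunE /=; case: unliftP => [j ->|->]; last by rewrite eqxx.
  by rewrite ffunE eq_sym (negPf (neq_lift _ _)).
apply: count_on_line => //; first exact/ltnW/ltn_ord.
move=> m; rewrite in_s1 -idx_x.
have xE : x = cube_point l (x i) by apply/ffunP => k; rewrite yE; case: eqP => // ->.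
case: (ltngtP m (x i)) => [lt_m|gt_m|/val_inj eq_m].
- apply: s_mono => [|k]; last by rewrite yE; case: eqP => // ->; apply: ltnW.
  by apply/eqP=> /ffunP/(_ i); rewrite yE eqxx => E; rewrite E ltnn in lt_m.
- apply/negbTE; rewrite -leqNgt ltnW //; apply: s_mono => [|k].
    by apply/eqP=> /ffunP/(_ i); rewrite yE eqxx => E; rewrite E ltnn in gt_m.
  by rewrite yE; case: eqP => // ->; apply: ltnW.
- by rewrite eq_m -xE ltnn.
Qed.

(** Induction along the order: after the points of a prefix have acted, each line
    has reached the position equal to the number of its points in that prefix. *)
Lemma block_transfer (F : fieldType) p (A : 'M[F]_3) (s : seq (point p)) psi :
  admissible_order s ->
  (forall (x : point p) j, psi j (line_point (line_through x j) (x j).+1)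
     = \sum_i psi i [ffun k => x k : nat] * A i j) ->
  face_row psi (fun=> 0%N) *m block A s = face_row psi (fun=> p).
Proof.
move=> s_adm psiP.
pose passed (s1 : seq (point p)) l := count (fun y => on_line y l) s1.
have step s1 s2 : s = s1 ++ s2 ->
    face_row psi (passed s1) *m block A s2 = face_row psi (passed s).
  elim: s2 s1 => [|x s2 IH] s1 def_s.
    by rewrite /block big_nil mulmx1 def_s cats0.
  rewrite /block big_cons -[_ * _]/(_ *m _) mulmxA.
  rewrite (@face_row_local _ _ _ _ _ _ (passed (rcons s1 x))) //.
  - by apply: IH; rewrite cat_rcons.
  - by move=> i; apply: (@count_below_line _ _ _ _ s2); rewrite -def_s.
  - by move=> l; rewrite /passed -cats1 count_cat /= addn0.
rewrite (step [::] s erefl); apply/rowP => a; rewrite !mxE /=.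
congr (psi _ (line_point _ _)).
have [s_uniq s_all _] := s_adm.
by apply: count_on_line => // m; rewrite s_all ltn_ord.
Qed.

(** * Symmetric powers of a two by two matrix *)

(** A polynomial of degree at most [d], homogenized to degree [d]. *)
Definition hom_eval (F : fieldType) (R : comAlgType F) d (P : {poly F}) (s t : R) :=
  \sum_(a < d.+1) P`_a *: (s ^+ a * t ^+ (d - a)).

(** Row [i] of [g] as the form [g i 0 s + g i 1 t], dehomogenized at [t = 1]. *)
Definition linear_form (F : fieldType) (g : 'M[F]_2) (i : 'I_2) : {poly F} :=
  g i 0 *: 'X + (g i 1)%:P.

(** The action of [g] on the [q]-th symmetric power of the plane, in the basis of
    monomials. *)
Definition sym_power (F : fieldType) q (g : 'M[F]_2) : 'M[F]_q.+1 :=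
  \matrix_(u, a) (linear_form g 0 ^+ u * linear_form g 1 ^+ (q - u))`_a.

Lemma size_linear_form (F : fieldType) (g : 'M[F]_2) i (P : {poly F}) d :
  (size P <= d)%N -> (size (linear_form g i * P)%R <= d.+1)%N.
Proof.
move=> sP; apply: leq_trans (size_polyMleq _ _) _.
have : (size (linear_form g i) <= 2)%N.
  rewrite /linear_form -mul_polyC size_MXaddC.
  by case: ifP => // _; rewrite ltnS size_polyC_leq1.
by move: (size _) (size _) sP => m n; lia.
Qed.

Lemma hom_evalM (F : fieldType) (R : comAlgType F) d (P : {poly F}) (s t : R) g i :
  (size P <= d.+1)%N ->
  hom_eval d.+1 (linear_form g i * P) s t
    = (g i 0 *: s + g i 1 *: t) * hom_eval d P s t.
Proof.
move=> sP; rewrite [RHS]mulrDl /hom_eval.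
under eq_bigr do rewrite /linear_form mulrDl -scalerAl coefD coefZ coefXM coefCM scalerDl.
rewrite big_split /=; congr (_ + _).
  rewrite big_ord_recl /= mulr0 scale0r add0r mulr_sumr.
  apply: eq_bigr => a _; rewrite /= /bump /= add1n subSS exprS.
  by rewrite -scalerA -!scalerAl -scalerAr mulrA.
rewrite big_ord_recr /= nth_default // mulr0 scale0r addr0 mulr_sumr.
apply: eq_bigr => a _; rewrite subSn ?exprS; last by rewrite -ltnS.
by rewrite -scalerA -!scalerAl -scalerAr mulrCA.
Qed.

Lemma sym_powerP (F : fieldType) (R : comAlgType F) q (g : 'M[F]_2) (s t : R)
    (u : 'I_q.+1) :
  (g 0 0 *: s + g 0 1 *: t) ^+ u * (g 1 0 *: s + g 1 1 *: t) ^+ (q - u)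
    = \sum_a sym_power q g u a *: (s ^+ a * t ^+ (q - a)).
Proof.
under eq_bigr do rewrite mxE.
rewrite -/(hom_eval q (linear_form g 0 ^+ u * linear_form g 1 ^+ (q - u)) s t).
have loop v w : (size (linear_form g 0 ^+ v * linear_form g 1 ^+ w)%R <= (v + w).+1)%N /\
    hom_eval (v + w) (linear_form g 0 ^+ v * linear_form g 1 ^+ w) s t =
    (g 0 0 *: s + g 0 1 *: t) ^+ v * (g 1 0 *: s + g 1 1 *: t) ^+ w.
  elim: v => [|v [szv IHv]].
    rewrite !mul1r add0n; elim: w => [|w [szw IHw]].
      by rewrite !expr0 size_poly1 /hom_eval big_ord1 coef1 scale1r mulr1.
    by rewrite !exprS size_linear_form // hom_evalM // IHw.
  by rewrite addSn !exprS -!mulrA size_linear_form // hom_evalM // IHv.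
by have [_ <-] := loop u (q - u)%N; rewrite subnKC // leq_ord.
Qed.

Lemma sym_power1 (F : fieldType) q : sym_power q 1%:M = 1%:M :> 'M[F]_q.+1.
Proof.
apply/matrixP => u a; rewrite !mxE /linear_form !mxE /= scale1r scale0r.
by rewrite addr0 add0r expr1n mulr1 coefXn eq_sym.
Qed.

(** Both sides expand the same product of forms: substitute the rows of [g] for the
    variables in the expansion given by [h]. *)
Lemma sym_powerM (F : fieldType) q (h g : 'M[F]_2) :
  sym_power q (h *m g) = sym_power q h *m sym_power q g.
Proof.
apply/matrixP => u a.
have formM i : linear_form (h *m g) i
    = h i 0 *: linear_form g 0 + h i 1 *: linear_form g 1.
  rewrite /linear_form !mxE !big_ord_recl !big_ord0 !addr0 /=.
  rewrite (_ : lift ord0 ord0 = 1); last exact: val_inj.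
  by rewrite -?mul_polyC ?polyCD ?polyCM; ring.
rewrite mxE !formM sym_powerP coef_sum [RHS]mxE.
by apply: eq_bigr => b _; rewrite coefZ [sym_power q g b a]mxE.
Qed.

Lemma sym_power_unit (F : fieldType) q (g : 'M[F]_2) :
  g \in unitmx -> sym_power q g \in unitmx.
Proof.
move=> g_unit; apply: (proj1 (mulmx1_unit (_ : _ *m sym_power q (invmx g) = 1%:M))).
by rewrite -sym_powerM mulmxV // sym_power1.
Qed.

(** * Indices modulo three *)

Lemma cyclic3_ind (P : 'I_3 -> 'I_3 -> 'I_3 -> Prop) :
  P 0 1 2 -> P 1 2 0 -> P 2 0 1 -> forall i, P i (i + 1) (i + 2).
Proof.
move=> P0 P1 P2 i; have : i \in [:: 0; 1; 2] by case: i => [[|[|[|]]]].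
rewrite !inE => /or3P[]/eqP->.
- by rewrite !add0r.
- have -> : 1 + 1 = 2 :> 'I_3 by apply: val_inj.
  by have -> : 1 + 2 = 0 :> 'I_3 by apply: val_inj.
- have -> : 2 + 1 = 0 :> 'I_3 by apply: val_inj.
  by have -> : 2 + 2 = 1 :> 'I_3 by apply: val_inj.
Qed.

Lemma sum_cyclic3 (V : zmodType) (f : 'I_3 -> V) i :
  \sum_j f j = f i + f (i + 1) + f (i + 2).
Proof.
have -> : \sum_j f j = f 0 + f 1 + f 2.
  rewrite !big_ord_recl big_ord0 addr0 addrA.
  by congr (f _ + f _ + f _); apply: val_inj.
move: i; apply: (cyclic3_ind (P := fun i j k => _ = f i + f j + f k)) => //.
  by rewrite -addrA addrC.
by rewrite addrC addrA.
Qed.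

Lemma add3_cycle (i : 'I_3) :
  (i + 1 + 1 = i + 2) * (i + 1 + 2 = i) * (i + 2 + 1 = i) * (i + 2 + 2 = i + 1).
Proof.
by split; [split; [split|]|]; rewrite -addrA; case: i => [[|[|[|]]]] // ?;
  apply: val_inj.
Qed.

Lemma cyclic3P (i j : 'I_3) : [\/ j = i, j = i + 1 | j = i + 2].
Proof.
by case: i j => [[|[|[|]]] // ?] [[|[|[|]]] // ?];
  (by constructor 1; apply: val_inj) || (by constructor 2; apply: val_inj)
  || (by constructor 3; apply: val_inj).
Qed.

Lemma add3_eqF (j : 'I_3) : ((j == j + 1) = false) * ((j == j + 2) = false)
  * ((j + 1 == j) = false) * ((j + 1 == j + 2) = false) * ((j + 2 == j) = false)
  * ((j + 2 == j + 1) = false).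
Proof. by case: j => [[|[|[|]]]]. Qed.

(** * Coordinates that make the surface of plane waves toric *)

(** Row 0 holds the coefficients of the numerator Z_i of z_i, and row 1 those of
    its denominator N_i, in the coordinates s_i and t_i.  Up to the factor u - v
    they invert s_i = a_{i+1,i+2} (z_i - a_ii) + a_{i+1,i} a_{i,i+2} and
    t_i = a_{i+2,i+1} (z_i - a_ii) + a_{i+2,i} a_{i,i+1}.  For generic [B], the
    zeros of s_i and t_i are the values of z_i on two lines of the surface along
    which an amplitude of the wave vanishes. *)
Definition chart_mx (F : fieldType) (B : 'M[F]_3) (i : 'I_3) : 'M[F]_2 :=
  \matrix_(u, v)
    if u == 0 then
      if v == 0 then B (i + 2) i * B i (i + 1) - B i i * B (i + 2) (i + 1)
      else B i i * B (i + 1) (i + 2) - B (i + 1) i * B i (i + 2)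
    else if v == 0 then - B (i + 2) (i + 1) else B (i + 1) (i + 2).

Lemma cyclic_products_neq (F : fieldType) (B : 'M[F]_3) i :
  B 0 1 * B 1 2 * B 2 0 != B 0 2 * B 2 1 * B 1 0 ->
  B i (i + 1) * B (i + 1) (i + 2) * B (i + 2) i
    - B i (i + 2) * B (i + 2) (i + 1) * B (i + 1) i != 0.
Proof.
rewrite -subr_eq0; set d := _ - _ => d_neq0.
suff <- : d = B i (i + 1) * B (i + 1) (i + 2) * B (i + 2) i
  - B i (i + 2) * B (i + 2) (i + 1) * B (i + 1) i by [].
move: i; apply: (cyclic3_ind (P := fun i j k =>
  d = B i j * B j k * B k i - B i k * B k j * B j i)); rewrite /d; ring.
Qed.

(** The determinant of the chart is u - v. *)
Lemma chart_mx_unit (F : fieldType) (B : 'M[F]_3) i :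
  B 0 1 * B 1 2 * B 2 0 != B 0 2 * B 2 1 * B 1 0 -> chart_mx B i \in unitmx.
Proof.
move=> /(cyclic_products_neq i) d_neq0.
rewrite unitmxE unitfE (expand_det_row _ 0) !big_ord_recl big_ord0.
rewrite /cofactor !det_mx11 !mxE /= addr0 expr0 mul1r expr1 mulN1r.
by apply: contraNneq d_neq0 => det0; rewrite -det0; apply/eqP; ring.
Qed.

(** The combination of rows [i] and [i + 2] of [B] with coefficients N_i at s_i and
    N_{i+2} at t_{i+2} has no entry in column [i + 1]; its other entries are the
    coefficients of Z_i and Z_{i+2} at the same places. *)
Lemma chart_mx_rows (F : fieldType) (B : 'M[F]_3) i (h := chart_mx B) :
  [/\ h i 0 0 = h i 1 0 * B i i + h (i + 2) 1 1 * B (i + 2) i,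
      h (i + 2) 0 1 = h i 1 0 * B i (i + 2) + h (i + 2) 1 1 * B (i + 2) (i + 2)
    & h i 1 0 * B i (i + 1) + h (i + 2) 1 1 * B (i + 2) (i + 1) = 0].
Proof. rewrite /h !mxE /= !add3_cycle; split; ring. Qed.

(** The analogous fact for the columns [i] and [i + 1] of [B]. *)
Lemma chart_mx_rows_tr (F : fieldType) (B : 'M[F]_3) i (h := chart_mx B) :
  [/\ h i 0 0 = h i 1 0 * B i i + h (i + 1) 1 1 * B i (i + 1),
      h (i + 1) 0 1 = h i 1 0 * B (i + 1) i + h (i + 1) 1 1 * B (i + 1) (i + 1)
    & h i 1 0 * B (i + 2) i + h (i + 1) 1 1 * B (i + 2) (i + 1) = 0].
Proof. rewrite /h !mxE /= !add3_cycle; split; ring. Qed.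

Lemma chart_mx_map (F : fieldType) (f : {rmorphism F -> F}) (B : 'M[F]_3) i :
  chart_mx (map_mx f B) i = map_mx f (chart_mx B i).
Proof.
apply/matrixP => u v; rewrite !mxE.
by do 2?case: ifP => _; rewrite ?rmorphB ?rmorphN ?rmorphM.
Qed.

(** The determinant of this cyclic system is a b c + a' b' c'. *)
Lemma cyclic_kernel (F : fieldType) (V : lmodType F) (x y z : V)
    (a b c a' b' c' : F) :
  a * b * c + a' * b' * c' != 0 ->
  a *: x + a' *: y = 0 -> b *: y + b' *: z = 0 -> c *: z + c' *: x = 0 -> x = 0.
Proof.
move=> det_neq0 /eqP; rewrite addr_eq0 => /eqP ax /eqP; rewrite addr_eq0 => /eqP yb.
move=> /eqP; rewrite addr_eq0 => /eqP cz.
apply/eqP; move: det_neq0; apply: contraNT => x_neq0.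
suff : (a * b * c + a' * b' * c') *: x = 0.
  by move/eqP; rewrite scaler_eq0 (negPf x_neq0) orbF.
rewrite scalerDl -mulrA mulrC -[X in X + _]scalerA ax scalerN scalerA.
rewrite (_ : b * c * a' = c * a' * b); last by ring.
rewrite -[X in - X + _]scalerA yb scalerN opprK scalerA.
rewrite (_ : c * a' * b' = a' * b' * c); last by ring.
by rewrite -[X in X + _]scalerA cz scalerN scalerA addNr.
Qed.

Section Solve.

Variables (F : fieldType) (B : 'M[F]_3) (n : nat) (R : 'M[F]_n).
Variable v : 'I_3 -> 'rV[F]_n.
Hypothesis hB : B 0 1 * B 1 2 * B 2 0 != B 0 2 * B 2 1 * B 1 0.
Local Notation h := (chart_mx B).

Lemma chart_mx_cycle i :
  h i 1 0 * h (i + 1) 1 0 * h (i + 2) 1 0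
    + h i 1 1 * h (i + 1) 1 1 * h (i + 2) 1 1 != 0.
Proof.
rewrite !mxE /= !add3_cycle; have := cyclic_products_neq i hB.
by apply: contraNneq => det0; rewrite -det0; apply/eqP; ring.
Qed.

(** The three equations determine the vectors [v i *m R], because the determinant of
    the system is u - v, and by [chart_mx_rows] the action of [B] solves them. *)
Lemma solve_chart :
  (forall i, (h i 1 0 *: v i + h (i + 2) 1 1 *: v (i + 2)) *m R
     = h i 0 0 *: v i + h (i + 2) 0 1 *: v (i + 2)) ->
  forall i, v i *m R = \sum_j B i j *: v j.
Proof.
move=> hv i; apply/eqP; rewrite -subr_eq0; apply/eqP.
pose w i := v i *m R - \sum_j B i j *: v j.
have wE j : h j 1 0 *: w j + h (j + 2) 1 1 *: w (j + 2) = 0.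
  have [E0 E1 E2] := chart_mx_rows B j.
  rewrite /w !scalerBr addrACA -opprD !scalemxAl -mulmxDl hv.
  rewrite !(sum_cyclic3 _ j) !scalerDr !scalerA [X in _ - X]addrACA.
  rewrite [X in _ - (X + _)]addrACA -!scalerDl -E0 -E1 E2 scale0r addr0.
  by rewrite subrr.
have H1 := wE i; have H2 := wE (i + 2); have H3 := wE (i + 1).
rewrite !add3_cycle in H2 H3.
apply: cyclic_kernel H1 H2 H3.
by apply: contra (chart_mx_cycle i) => /eqP E; apply/eqP; rewrite -[RHS]E; ring.
Qed.

Lemma solve_chart_tr :
  (forall i, (h i 1 0 *: v i + h (i + 1) 1 1 *: v (i + 1)) *m R
     = h i 0 0 *: v i + h (i + 1) 0 1 *: v (i + 1)) ->
  forall i, v i *m R = \sum_j B^T i j *: v j.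
Proof.
move=> hv i; under eq_bigr do rewrite mxE.
apply/eqP; rewrite -subr_eq0; apply/eqP.
pose w i := v i *m R - \sum_j B j i *: v j.
have wE j : h j 1 0 *: w j + h (j + 1) 1 1 *: w (j + 1) = 0.
  have [E0 E1 E2] := chart_mx_rows_tr B j.
  rewrite /w !scalerBr addrACA -opprD !scalemxAl -mulmxDl hv.
  rewrite !(sum_cyclic3 _ j) !scalerDr !scalerA [X in _ - X]addrACA.
  rewrite [X in _ - (X + _)]addrACA -!scalerDl -E0 -E1 E2 scale0r addr0.
  by rewrite subrr.
have H1 := wE i; have H2 := wE (i + 1); have H3 := wE (i + 2).
rewrite !add3_cycle in H2 H3.
apply: cyclic_kernel H1 H2 H3.
by apply: contra (chart_mx_cycle i) => /eqP E; apply/eqP; rewrite -[RHS]E; ring.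
Qed.

End Solve.

(** * Plane waves *)

Section Wave.

Variables (F : fieldType) (R : comAlgType F) (q : nat) (A : 'M[F]_3).
Variables (s t c : 'I_3 -> R).
Hypothesis stc : forall i, c i * t i = c (i + 1) * s (i + 1).
Local Notation p := q.+1.

(** [edge_form 0 i] is Z_i and [edge_form 1 i] is N_i. *)
Definition edge_form (u : 'I_2) i :=
  chart_mx A i u 0 *: s i + chart_mx A i u 1 *: t i.

(** The equation c diag(z) = c A of a plane wave, with amplitudes c_i N_i in place
    of c_i to clear the denominators.  By [stc] both sides are combinations of
    the three elements x_i = c_i s_i. *)
Lemma edge_formP j : c j * edge_form 0 j = \sum_i A i j *: (c i * edge_form 1 i).
Proof.
pose x i := c i * s i.
have formE u i : c i * edge_form u i
    = chart_mx A i u 0 *: x i + chart_mx A i u 1 *: x (i + 1).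
  by rewrite mulrDr -!scalerAr stc.
rewrite (sum_cyclic3 _ j) !formE !add3_cycle.
have [E00 _ _] := chart_mx_rows A j.
have [_ E01 _] := chart_mx_rows A (j + 1).
have [_ _ E] := chart_mx_rows A (j + 2).
rewrite !add3_cycle in E00 E01 E.
(* The coefficient of x_{j+2} on the right is zero by E. *)
rewrite -[LHS]addr0 -(scale0r (x (j + 2))) -E E00 E01 !scalerDr !scalerA !scalerDl.
rewrite ![A _ _ * chart_mx _ _ _ _]mulrC; ring.
Qed.

Definition edge_power k n := edge_form 0 k ^+ n * edge_form 1 k ^+ (q - n).

(** The plane wave c_i N_i z^x multiplied by the common denominator of all its
    values on the edges of the cube. *)
Definition wave i (x : {ffun 'I_3 -> nat}) :=
  c i * (edge_form 1 i ^+ (p - x i) * edge_form 0 i ^+ x i)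
    * (edge_power (i + 1) (x (i + 1)) * edge_power (i + 2) (x (i + 2))).

Lemma wave_step (x : point p) j :
  wave j (line_point (line_through x j) (x j).+1)
    = \sum_i A i j *: wave i [ffun k => x k : nat].
Proof.
pose e := \prod_k edge_power k (x k).
have eE i : e = edge_power i (x i)
    * (edge_power (i + 1) (x (i + 1)) * edge_power (i + 2) (x (i + 2))).
  have -> : e = edge_power 0 (x 0) * edge_power 1 (x 1) * edge_power 2 (x 2).
    rewrite /e !big_ord_recl big_ord0 mulr1 mulrA.
    by congr (edge_power _ (x _) * edge_power _ (x _) * edge_power _ (x _));
      apply: val_inj.
  move: i; apply: (cyclic3_ind (P := fun i j k => _ = edge_power i (x i)
    * (edge_power j (x j) * edge_power k (x k)))); ring.
have -> : wave j (line_point (line_through x j) (x j).+1) = c j * edge_form 0 j * e.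
  rewrite /wave !line_point_through eqxx.
  have -> : (j + 1 == j) = false by case: j => [[|[|[|]]]].
  have -> : (j + 2 == j) = false by case: j => [[|[|[|]]]].
  rewrite (eE j) /edge_power subSS exprS; ring.
rewrite edge_formP mulr_suml; apply: eq_bigr => i _.
rewrite -scalerAl; congr (_ *: _).
rewrite /wave !ffunE (eE i) /edge_power subSn ?exprS; last exact: leq_ord.
by ring.
Qed.


Hypothesis charFp : p \in [pchar F].

Definition face_monomial i (k : 'I_p * 'I_p) :=
  s (i + 1) ^+ k.1 * t (i + 1) ^+ (q - k.1)
  * (s (i + 2) ^+ k.2 * t (i + 2) ^+ (q - k.2)).

Definition face_coef i (k : 'I_p * 'I_p) (m n : 'I_p) : F :=
  sym_power q (chart_mx A (i + 1)) m k.1 * sym_power q (chart_mx A (i + 2)) n k.2.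

Lemma edge_powerE k (n : 'I_p) :
  edge_power k n = \sum_a sym_power q (chart_mx A k) n a *: (s k ^+ a * t k ^+ (q - a)).
Proof. exact: sym_powerP. Qed.

(** [u = 1] is the entering face and [u = 0] the leaving one.  The p-th power of
    the remaining form N_i or Z_i involves only s_i^p and t_i^p, by additivity of
    the Frobenius map. *)
Lemma wave_face (u : 'I_2) i (x : {ffun 'I_3 -> nat}) (m n : 'I_p) :
  x i = (if u == 0 then p else 0%N) -> x (i + 1) = m -> x (i + 2) = n ->
  wave i x = \sum_k face_coef i k m n *:
    (chart_mx A i u 0 ^+ p *: (c i * s i ^+ p * face_monomial i k)
     + chart_mx A i u 1 ^+ p *: (c i * t i ^+ p * face_monomial i k)).
Proof.
move=> xi xj xk.
have p_nat : [pchar R].-nat p.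
  by rewrite pnatE ?(pcharf_prime charFp) // pchar_lalg.
have -> : wave i x = c i * edge_form u i ^+ p * (edge_power (i + 1) m * edge_power (i + 2) n).
  rewrite /wave xi xj xk.
  case: u xi => [[|[|]]] //= lt_u _; rewrite ?subnn ?subn0 expr0 ?mul1r ?mulr1;
    by congr (_ * _ ^+ _ * _); congr edge_form; apply: val_inj.
rewrite /edge_form exprDn_pchar // !exprZn !edge_powerE mulr_suml mulr_sumr.
under eq_bigr do rewrite !mulr_sumr.
rewrite pair_bigA /=; apply: eq_bigr => -[a b] _ /=.
rewrite /face_coef /face_monomial /= !(mulrDl, mulrDr) -!(scalerAl, scalerAr).
rewrite !(scalerDr, scalerA).
by rewrite [_ ^+ p * (_ * _)]mulrC.
Qed.

Definition line_coord (l : line p) k : 'I_p :=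
  if unlift l.1 k is Some j then l.2 j else ord0.

(** The coefficient vector of [face_monomial i k] in the wave on the [i]-th faces. *)
Definition face_basis i k : 'rV[F]_#|{: line p}| :=
  \row_a let l := enum_val a in
    (l.1 == i)%:R * face_coef i k (line_coord l (i + 1)) (line_coord l (i + 2)).

Lemma line_point_coord (l : line p) n k : k != l.1 -> line_point l n k = line_coord l k.
Proof. by rewrite ffunE /line_coord; case: unliftP => [//|->]; rewrite eqxx. Qed.

(** A functional [eps] that sees a single monomial with s_i^p and a single one with
    t_{i'}^p turns the wave into a scalar field whose face values are combinations
    of just two basis vectors. *)
Lemma face_row_wave (eps : {scalar R}) (u : 'I_2) i i' (k k' : 'I_p * 'I_p) :
  (forall j h, eps (c j * s j ^+ p * face_monomial j h) = ((j == i) && (h == k))%:R) ->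
  (forall j h, eps (c j * t j ^+ p * face_monomial j h) = ((j == i') && (h == k'))%:R) ->
  face_row (fun j x => eps (wave j x)) (fun=> if u == 0 then p else 0%N)
    = chart_mx A i u 0 ^+ p *: face_basis i k + chart_mx A i' u 1 ^+ p *: face_basis i' k'.
Proof.
move=> epsS epsT; apply/rowP => a.
rewrite [LHS]mxE [RHS]mxE [X in _ = X + _]mxE [X in _ = _ + X]mxE.
rewrite [face_basis i k _ _]mxE [face_basis i' k' _ _]mxE.
move: (enum_val a) => l; cbv zeta; set j := l.1.
rewrite (@wave_face u j _ (line_coord l (j + 1)) (line_coord l (j + 2))); first last.
- by rewrite line_point_coord ?add3_eqF.
- by rewrite line_point_coord ?add3_eqF.
- by rewrite ffunE unlift_none.
rewrite linear_sum /=.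
under eq_bigr do rewrite linearZ linearD !linearZ /= epsS epsT mulrDr.
rewrite big_split /=; congr (_ + _).
  case: eqP => [->|_] /=; last by rewrite mul0r mulr0 big1 // => h _; rewrite !mulr0.
  rewrite (bigD1 k) //= eqxx mulr1 mul1r mulrC big1 ?addr0 // => h /negPf->.
  by rewrite !mulr0.
case: eqP => [->|_] /=; last by rewrite mul0r mulr0 big1 // => h _; rewrite !mulr0.
rewrite (bigD1 k') //= eqxx mulr1 mul1r mulrC big1 ?addr0 // => h /negPf->.
by rewrite !mulr0.
Qed.

Lemma block_face_basis (ord : seq (point p)) (eps : {scalar R}) i i' (k k' : 'I_p * 'I_p) :
  admissible_order ord ->
  (forall j h, eps (c j * s j ^+ p * face_monomial j h) = ((j == i) && (h == k))%:R) ->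
  (forall j h, eps (c j * t j ^+ p * face_monomial j h) = ((j == i') && (h == k'))%:R) ->
  (chart_mx A i 1 0 ^+ p *: face_basis i k + chart_mx A i' 1 1 ^+ p *: face_basis i' k')
     *m block A ord
    = chart_mx A i 0 0 ^+ p *: face_basis i k + chart_mx A i' 0 1 ^+ p *: face_basis i' k'.
Proof.
move=> ord_adm epsS epsT.
rewrite -!(@face_row_wave eps _ i i' k k') //=; apply: block_transfer => // x j.
rewrite wave_step linear_sum /=.
by apply: eq_bigr => m _; rewrite linearZ /= mulrC.
Qed.

End Wave.

(** * Bases of the thick spaces *)

(** [freeP] indexed by the finite type itself instead of the positions in its
    enumeration. *)
Lemma free_map_enum (F : fieldType) (V : vectType F) (T : finType) (f : T -> V) :
  (forall c : T -> F, \sum_x c x *: f x = 0 -> forall x, c x = 0) ->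
  free [seq f x | x <- enum T].
Proof.
move=> f_free.
have sz : size [seq f x | x <- enum T] == #|T| by rewrite size_map cardE.
apply/(freeP (X := Tuple sz)) => c c0 j.
rewrite -[j]enum_valK; apply: (f_free (fun x => c (enum_rank x))).
rewrite -[RHS]c0 [RHS](reindex (@enum_rank T)) /=; last exact/onW_bij/enum_rank_bij.
apply: eq_bigr => x _; congr (_ *: _).
by rewrite (nth_map x) -?cardE // nth_enum_rank.
Qed.

Section FaceBasis.

Variables (F : fieldType) (q : nat) (A : 'M[F]_3).
Hypothesis hA : A 0 1 * A 1 2 * A 2 0 != A 0 2 * A 2 1 * A 1 0.
Local Notation p := q.+1.

(** Up to the numbering of coordinates, the transition matrix from the lines to
    these vectors is the tensor product of two symmetric powers of invertible
    charts. *)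
Lemma face_basis_free i : free [seq face_basis A i k | k <- enum {: 'I_p * 'I_p}].
Proof.
apply: free_map_enum => c c0.
pose C := \matrix_(a, b) c (a, b).
have : sym_power q (chart_mx A (i + 1)) *m C *m (sym_power q (chart_mx A (i + 2)))^T = 0.
  apply/matrixP => m n; rewrite [RHS]mxE.
  pose l := line_through ([ffun k => if k == i + 1 then m else n] : point p) i.
  have lE k : k != i -> line_coord l k = if k == i + 1 then m else n.
    by rewrite /line_coord /=; case: unliftP => [j ->|->]; rewrite ?eqxx // !ffunE.
  transitivity ((\sum_k c k *: face_basis A i k) 0 (enum_rank l)); last by rewrite c0 mxE.
  rewrite summxE mxE; under eq_bigr do rewrite mxE mulr_suml.
  rewrite exchange_big pair_bigA /=; apply: eq_bigr => -[a b] _ /=.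
  rewrite [C a b]mxE [_^T _ _]mxE [RHS]mxE [face_basis _ _ _ _ _]mxE.
  cbv zeta; rewrite enum_rankK (eqxx i : (l.1 == i) = true) mul1r.
  rewrite !lE ?add3_eqF // eqxx /face_coef /=; ring.
move=> C0 [a b].
have U j : sym_power q (chart_mx A j) \in unitmx by apply/sym_power_unit/chart_mx_unit.
move/(canRL (mulmxK _)): C0; rewrite unitmx_tr U mul0mx => /(_ isT).
move/(canRL (mulKmx (U _))); rewrite mulmx0 => /matrixP/(_ a b).
by rewrite !mxE.
Qed.

Lemma face_basis_in_thick i k : face_basis A i k \in thick F p i.
Proof.
rewrite [face_basis A i k]row_sum_delta; apply: memv_suml => j _.
rewrite mxE; cbv zeta; case def_l: (enum_val j) => [l1 u] /=.
case: eqP => [<-|_]; last by rewrite mul0r scale0r mem0v.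
apply/memvZ/memv_span/mapP; exists u; first by rewrite mem_enum.
by rewrite -def_l enum_valK.
Qed.

Lemma face_basis_basis i (ks : seq ('I_p * 'I_p)) :
  perm_eq ks (enum {: 'I_p * 'I_p}) ->
  basis_of (thick F p i) [seq face_basis A i k | k <- ks].
Proof.
move=> ks_perm; have ks_free : free [seq face_basis A i k | k <- ks].
  by rewrite (perm_free (perm_map _ ks_perm)) face_basis_free.
rewrite basisEfree ks_free /=; apply/andP; split.
  by apply/span_subvP => _ /mapP[k _ ->]; apply: face_basis_in_thick.
apply: leq_trans (dim_span _) _.
by rewrite !size_map (perm_size ks_perm) -?enumT -!cardE card_ffun card_prod !card_ord mulnn.
Qed.

End FaceBasis.

(** * Splitting by the exponents modulo p *)

Lemma mnm3E (m n : 'X_{1..3}) i :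
  (m == n) = [&& m i == n i, m (i + 1) == n (i + 1) & m (i + 2) == n (i + 2)].
Proof.
apply/eqP/and3P => [->//|[/eqP mi /eqP mj /eqP mk]]; apply/mnmP => j.
by case: (cyclic3P i j) => ->.
Qed.

Lemma mcoeff_monomial3 (F : fieldType) i (a b d : nat) M :
  ('X_i ^+ a * 'X_(i + 1) ^+ b * 'X_(i + 2) ^+ d : {mpoly F[3]})@_M
  = [&& a == M i, b == M (i + 1) & d == M (i + 2)]%:R.
Proof.
rewrite !mpolyXn -!mpolyXD mcoeffX (mnm3E _ _ i) !mnmDE !mulmnE !mnm1E.
case: i => [[|[|[|]]] // ?]; rewrite /= ?(muln0, muln1, mul0n, mul1n, addn0, add0n) //.
Qed.

Section Blocks.

Variable q : nat.
Local Notation p := q.+1.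
Implicit Type k : 'I_p * 'I_p.

(** The residues modulo p of the exponents of X_0, X_1, X_2: the first two are free
    and the third makes the sum congruent to p - 1, where p = q + 1. *)
Definition residue k (i : 'I_3) : 'I_p :=
  inord (nth 0%N [:: k.1 : nat; k.2 : nat; ((p + q - (k.1 + k.2)) %% p)%N] i).

Definition small_sum k := (k.1 + k.2 < p)%N.

Lemma residue_sum k i :
  (residue k i + residue k (i + 1)%R + residue k (i + 2)%R
     = if small_sum k then q else p + q)%N.
Proof.
have -> : (residue k i + residue k (i + 1)%R + residue k (i + 2)%R =
           residue k 0%R + residue k 1%R + residue k 2%R)%N.
  apply: (cyclic3_ind (P := fun i j l => residue k i + residue k j + residue k l = _)%N); lia.
case: k => a b; rewrite /residue /small_sum /= !inordK ?ltn_mod //=.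
case: ifP => ?; have ? := ltn_ord a; have ? := ltn_ord b; last by rewrite modn_small; lia.
have -> : ((p + q - (a + b)) %% p = q - (a + b))%N; last by lia.
by rewrite -addnBA ?modnDl ?modn_small //; lia.
Qed.

(** The monomial c_i s_{i+1}^a t_{i+1}^(q-a) s_{i+2}^b t_{i+2}^(q-b) is
    X_i^(q-a) X_{i+1}^(p+a-b) X_{i+2}^b, so the residues of the exponents of X_i
    and X_{i+2} give a and b back. *)
Definition slot k i : 'I_p * 'I_p := (rev_ord (residue k i), residue k (i + 2)).

(** Two residues determine the third, whose value is known modulo p. *)
Lemma slot_inj i : injective (slot^~ i).
Proof.
move=> k k' E0; have Ei := congr1 (fun h : 'I_p * 'I_p => h.1 : nat) E0.
have {E0} Ei2 := congr1 (fun h : 'I_p * 'I_p => h.2 : nat) E0; rewrite /= in Ei Ei2.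
have S := residue_sum k i; have S' := residue_sum k' i.
have E j : residue k j = residue k' j :> nat.
  have L := ltn_ord (residue k i); have L' := ltn_ord (residue k' i).
  have M := ltn_ord (residue k (i + 1)); have M' := ltn_ord (residue k' (i + 1)).
  by case: (cyclic3P i j) => ->; move: S S'; do 2?case: ifP => _; lia.
case: k k' E {Ei Ei2 S S'} => [a b] [a' b'] E.
by congr pair; apply: val_inj; [have := E 0 | have := E 1];
  rewrite /residue /= !inordK.
Qed.

Definition exponents k (up : pred 'I_3) : 'X_{1..3} :=
  [multinom (residue k j + p * up j)%N | j < 3].

(** The monomials of the wave with given residues: c_i s_i^p times the monomial of
   [slot k i] has, among the exponents of X_0, X_1, X_2, all but that of X_{i+2}
   at least p if the residues add up to p - 1, and only that of X_i at least p if
   they add up to 2p - 1. *)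
Definition raise_small (i : 'I_3) : pred 'I_3 := fun j => j != i + 2.
Definition raise_large (i : 'I_3) : pred 'I_3 := fun j => j == i.

Variable F : fieldType.

Local Notation s := (fun i : 'I_3 => 'X_i : {mpoly F[3]}).
Local Notation t := (fun i : 'I_3 => 'X_(i + 2) : {mpoly F[3]}).
Local Notation c := (fun i : 'I_3 => 'X_(i + 1) : {mpoly F[3]}).

Lemma mcoeff_S j (h : 'I_p * 'I_p) M :
  (c j * s j ^+ p * face_monomial s t j h)@_M
  = [&& p + (q - h.1) == M j, p + h.1 - h.2 == M (j + 1)%R
      & h.2 == M (j + 2)%R :> nat]%N%:R :> F.
Proof.
rewrite -mcoeff_monomial3 /face_monomial !add3_cycle; congr (_ @_ M).
have -> : (p + h.1 - h.2 = 1 + h.1 + (q - h.2))%N by have := ltn_ord h.2; lia.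
rewrite !exprD expr1.
by move: (_ ^+ p) (_ ^+ (q - h.1)) (_ ^+ h.1) (_ ^+ h.2) (_ ^+ (q - h.2)) => *; ring.
Qed.

Lemma mcoeff_T j (h : 'I_p * 'I_p) M :
  (c j * t j ^+ p * face_monomial s t j h)@_M
  = [&& q - h.1 == M j, p + h.1 - h.2 == M (j + 1)%R
      & p + h.2 == M (j + 2)%R :> nat]%N%:R :> F.
Proof.
rewrite -mcoeff_monomial3 /face_monomial !add3_cycle; congr (_ @_ M).
have -> : (p + h.1 - h.2 = 1 + h.1 + (q - h.2))%N by have := ltn_ord h.2; lia.
rewrite !exprD expr1.
by move: (_ ^+ p) (_ ^+ (q - h.1)) (_ ^+ h.1) (_ ^+ h.2) (_ ^+ (q - h.2)) => *; ring.
Qed.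

Lemma mem_slot (h : 'I_p * 'I_p) k i : (h == slot k i) =
  (h.1 + residue k i == q)%N && (h.2 == residue k (i + 2) :> nat).
Proof.
case: h => a b; rewrite /slot xpair_eqE -!val_eqE /=.
by have := ltn_ord (residue k i); have := ltn_ord a; lia.
Qed.

(** The next four lemmas express two identities between the monomials attached to
    the slots m_i of one [k]: c_i s_i^p m_i = c_{i+2} t_{i+2}^p m_{i+2} when the
    residues add up to p - 1, and c_i s_i^p m_i = c_{i+1} t_{i+1}^p m_{i+1} when
    they add up to 2p - 1; no other term of the wave shares these exponents. *)
Lemma mcoeff_S_small k i j h : small_sum k ->
  (c j * s j ^+ p * face_monomial s t j h)@_(exponents k (raise_small i))
  = ((j == i) && (h == slot k i))%:R :> F.
Proof.
move=> k_small; rewrite mcoeff_S mem_slot !mnmE /raise_small; congr (nat_of_bool _)%:R.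
have := residue_sum k i; rewrite k_small.
have := ltn_ord h.1; have := ltn_ord h.2.
have := ltn_ord (residue k i); have := ltn_ord (residue k (i + 1)).
have := ltn_ord (residue k (i + 2)).
by case: (cyclic3P i j) => ->; rewrite ?(add3_cycle, eqxx, add3_eqF) /=; lia.
Qed.

Lemma mcoeff_T_small k i j h : small_sum k ->
  (c j * t j ^+ p * face_monomial s t j h)@_(exponents k (raise_small i))
  = ((j == i + 2) && (h == slot k (i + 2)))%:R :> F.
Proof.
move=> k_small; rewrite mcoeff_T mem_slot !mnmE /raise_small; congr (nat_of_bool _)%:R.
have := residue_sum k i; rewrite k_small.
have := ltn_ord h.1; have := ltn_ord h.2.
have := ltn_ord (residue k i); have := ltn_ord (residue k (i + 1)).
have := ltn_ord (residue k (i + 2)).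
by case: (cyclic3P i j) => ->; rewrite ?(add3_cycle, eqxx, add3_eqF) /=; lia.
Qed.

Lemma mcoeff_S_large k i j h : ~~ small_sum k ->
  (c j * s j ^+ p * face_monomial s t j h)@_(exponents k (raise_large i))
  = ((j == i) && (h == slot k i))%:R :> F.
Proof.
move=> k_large; rewrite mcoeff_S mem_slot !mnmE /raise_large; congr (nat_of_bool _)%:R.
have := residue_sum k i; rewrite (negPf k_large).
have := ltn_ord h.1; have := ltn_ord h.2.
have := ltn_ord (residue k i); have := ltn_ord (residue k (i + 1)).
have := ltn_ord (residue k (i + 2)).
by case: (cyclic3P i j) => ->; rewrite ?(add3_cycle, eqxx, add3_eqF) /=; lia.
Qed.

Lemma mcoeff_T_large k i j h : ~~ small_sum k ->
  (c j * t j ^+ p * face_monomial s t j h)@_(exponents k (raise_large i))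
  = ((j == i + 1) && (h == slot k (i + 1)))%:R :> F.
Proof.
move=> k_large; rewrite mcoeff_T mem_slot !mnmE /raise_large; congr (nat_of_bool _)%:R.
have := residue_sum k i; rewrite (negPf k_large).
have := ltn_ord h.1; have := ltn_ord h.2.
have := ltn_ord (residue k i); have := ltn_ord (residue k (i + 1)).
have := ltn_ord (residue k (i + 2)).
by case: (cyclic3P i j) => ->; rewrite ?(add3_cycle, eqxx, add3_eqF) /=; lia.
Qed.

End Blocks.

(** * The direct sum decomposition *)

Lemma card_small_sum q :
  (2 * size [seq k <- enum {: 'I_q.+1 * 'I_q.+1} | small_sum k] = q.+1 * q.+2)%N.
Proof.
have -> : size [seq k <- enum {: 'I_q.+1 * 'I_q.+1} | small_sum k]
    = (\sum_(a < q.+1) (q.+1 - a))%N.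
  rewrite size_filter -sum1_count big_enum_cond /=.
  rewrite -(pair_big_dep xpredT (fun a b : 'I_q.+1 => small_sum (a, b)) (fun _ _ => 1%N)) /=.
  apply: eq_bigr => a _; rewrite -[RHS]card_ord -sum1_card.
  rewrite (big_ord_widen q.+1 (fun=> 1%N)) ?leq_subr //; apply: eq_bigl => b.
  by rewrite /small_sum /= ltn_subRL.
elim: q => [|q IH]; first by rewrite big_ord1.
by rewrite big_ord_recl subn0 mulnDr IH; lia.
Qed.

Theorem corollary9 (F : fieldType) (p : nat) (charFp : p \in [pchar F])
    (A : 'M[F]_3)
    (hA : A 0 1 * A 1 2 * A 2 0 != A 0 2 * A 2 1 * A 1 0)
    (s : seq (point p)) (hs : admissible_order s) :
  let r : 'M[F]_3 := \matrix_(i, j) A i j ^+ p in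
  is_direct_sum (block A s)
    (nseq ((p * (p - 1)) %/ 2)%N r^T ++ nseq ((p * (p + 1)) %/ 2)%N r).
Proof.
move=> r; case: p charFp s hs @r => [|q] charFp s hs r.
  by have := pcharf_prime charFp.
have rE : r = map_mx (pFrobenius_aut charFp) A.
  by apply/matrixP => i j; rewrite !mxE.
have hr : r 0 1 * r 1 2 * r 2 0 != r 0 2 * r 2 1 * r 1 0.
  by rewrite rE !mxE -!rmorphM fmorph_eq.
have chartE i u v : chart_mx A i u v ^+ q.+1 = chart_mx r i u v.
  by rewrite rE chart_mx_map [RHS]mxE.
set ks := [seq k <- enum {: 'I_q.+1 * 'I_q.+1} | ~~ small_sum k]
       ++ [seq k <- enum {: 'I_q.+1 * 'I_q.+1} | small_sum k].
have ks_perm : perm_eq ks (enum {: 'I_q.+1 * 'I_q.+1}).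
  by rewrite perm_catC perm_filterC.
have size_ks : size ks = (q.+1 ^ 2)%N.
  by rewrite (perm_size ks_perm) -cardE card_prod card_ord mulnn.
have msE : nseq ((q.+1 * (q.+1 - 1)) %/ 2)%N r^T ++ nseq ((q.+1 * (q.+1 + 1)) %/ 2)%N r
    = [seq if small_sum k then r else r^T | k <- ks].
  have mapE (P : pred ('I_q.+1 * 'I_q.+1)) (m : 'M[F]_3) (f : 'I_q.+1 * 'I_q.+1 -> 'M[F]_3) :
      (forall k, P k -> f k = m) ->
      [seq f k | k <- enum {: 'I_q.+1 * 'I_q.+1} & P k]
        = nseq (size [seq k <- enum {: 'I_q.+1 * 'I_q.+1} | P k]) m.
    move=> fE; rewrite -(size_map f); apply/all_pred1P/allP => x /mapP[k].
    by rewrite mem_filter => /andP[/fE fk _] ->; rewrite /= fk.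
  rewrite map_cat (mapE _ r^T) => [|k /negPf->//].
  rewrite (mapE _ r) => [|k ->//].
  have := card_small_sum q; move: size_ks; rewrite size_cat.
  by move=> S1 S2; congr (nseq _ _ ++ nseq _ _); lia.
rewrite msE; split; first by rewrite size_map.
have v_size i : size [seq face_basis A i (slot k i) | k <- ks] == (q.+1 ^ 2)%N.
  by rewrite size_map size_ks.
exists (fun i => Tuple (v_size i)); split=> [i|k i].
  rewrite /= (_ : map _ _ = [seq face_basis A i h | h <- [seq slot k i | k <- ks]]);
    last by rewrite -map_comp.
  apply: face_basis_basis => //; apply: uniq_perm; rewrite ?enum_uniq //.
    by rewrite (map_inj_uniq (@slot_inj q i)) (perm_uniq ks_perm) enum_uniq.
  move=> h; rewrite mem_enum inE; have [g _ gK] := injF_bij (@slot_inj q i).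
  by apply/mapP; exists (g h); rewrite ?gK // (perm_mem ks_perm) mem_enum.
have lt_k : (k < size ks)%N by rewrite size_ks.
have k0 : 'I_q.+1 * 'I_q.+1 := (ord0, ord0).
rewrite (nth_map k0) // (tnth_nth 0) /= (nth_map k0) //.
under eq_bigr do rewrite (tnth_nth 0) /= (nth_map k0) //.
move: (nth k0 ks k) => {lt_k k0} k0.
pose c j := 'X_(j + 1) : {mpoly F[3]}; pose sX j := 'X_j : {mpoly F[3]}.
pose tX j := 'X_(j + 2) : {mpoly F[3]}.
have stc j : c j * tX j = c (j + 1) * sX (j + 1) by rewrite /c /tX /sX add3_cycle mulrC.
case: ifPn => [k_small|k_large].
  apply: (solve_chart (v := fun i => face_basis A i (slot k0 i))) => // j.
  rewrite -!chartE; apply: (@block_face_basis F _ q A sX tX c stc charFp s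
    (mcoeff (exponents k0 (raise_small j)))) => // j' h.
    exact: mcoeff_S_small.
  exact: mcoeff_T_small.
apply: (solve_chart_tr (v := fun i => face_basis A i (slot k0 i))) => // j.
rewrite -!chartE; apply: (@block_face_basis F _ q A sX tX c stc charFp s
    (mcoeff (exponents k0 (raise_large j)))) => // j' h.
  exact: mcoeff_S_large.
exact: mcoeff_T_large.
Qed.
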